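(* Let $f_1,\dots,f_N:\mathbb{R}^n\to\mathbb{R}^n$ be contracting similarities with ratios $\rho_1,\dots,\rho_N\in(0,1)$, let $C\subset\mathbb{R}^n$ be a non-empty compact set, and let $E$ be a sub-self-similar set for $\{f_1,\dots,f_N\}$ with $E=\Theta(S)$, where $S\subseteq I^\infty$ is compact and closed under left shift. Let $O_S=C\cup\bigcup_{\omega\in S^*}f_\omega(C)$ and $E_C=E\cup O_S$, and let $s\ge0$ be the unique non-negative number with $\tau(s)=\lim_{k\to\infty}\big(\sum_{\omega\in S^k}\rho_\omega^s\big)^{1/k}=1$. Then $$\max\{\overline{\dim}_B E,\overline{\dim}_B C\}\le\overline{\dim}_B E_C\le\max\{s,\overline{\dim}_B C\}.$$
   Context: $\overline{\dim}_B$ denotes upper box dimension. A non-empty compact set $E$ is a sub-self-similar (SSS) set for $\{f_1,\dots,f_N\}$ if $E\subseteq\bigcup_{i=1}^N f_i(E)$. Code space: $I=\{1,\dots,N\}$, $I^\infty$ is the set of infinite sequences in $I$ with the product topology. For a finite word $\omega=\omega_1\cdots\omega_m$ put $f_\omega=f_{\omega_1}\circ\cdots\circ f_{\omega_m}$ and $\rho_\omega=\rho_{\omega_1}\cdots\rho_{\omega_m}$. The coding map is $\Theta(\omega)=\lim_{m\to\infty}f_{\omega_1}\circ\cdots\circ f_{\omega_m}(x)$ (independent of $x$). $S$ is closed under left shift if $\omega_1\omega_2\omega_3\cdots\in S$ implies $\omega_2\omega_3\cdots\in S$. For $m\ge1$, $S^m=\{\omega_1\cdots\omega_m:\omega\in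 S\}$ and $S^*=\bigcup_{m\ge1}S^m$. The limit defining $\tau$ exists by submultiplicativity. *)

(* Defs.v *)
From HB Require Import structures.
From mathcomp Require Import all_boot all_order all_algebra.
From mathcomp Require Import all_classical all_reals all_analysis.

Set Implicit Arguments.
Unset Strict Implicit.
Unset Printing Implicit Defensive.

Import Order.TTheory GRing.Theory Num.Theory.
Import numFieldNormedType.Exports.

Local Open Scope classical_set_scope.
Local Open Scope ring_scope.

(* The library norm on ['rV[R]_n] is the sup norm. It induces the same topology
   as the Euclidean norm (so the library's [compact] and [lim] are the usual
   ones), but similarities must be taken with respect to the latter. *)
Definition euclid_norm (R : realType) (n : nat) (x : 'rV[R]_n) : R :=
  Num.sqrt (\sum_(i < n) x 0 i ^+ 2).

Definition is_similarity (R : realType) (n : nat) (r : R)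
    (f : 'rV[R]_n -> 'rV[R]_n) : Prop :=
  forall x y, euclid_norm (f x - f y) = r * euclid_norm (x - y).

Definition diam_le (R : realType) (n : nat) (A : set 'rV[R]_n) (d : R) : Prop :=
  forall x y, A x -> A y -> euclid_norm (x - y) <= d.

(* Least number of sets of diameter at most [d] that cover [A]; it is [+oo] when
   no finite cover exists. *)
Definition covering_number (R : realType) (n : nat) (A : set 'rV[R]_n) (d : R) :
    \bar R :=
  ereal_inf [set (k%:R)%:E | k in [set k : nat |
    exists U : 'I_k -> set 'rV[R]_n,
      (forall i, diam_le (U i) d) /\ A `<=` \bigcup_(i in [set: 'I_k]) U i]].

(* limsup of log N_d(A) / - log d as d tends to 0 from the right *)
Definition upper_box_dim (R : realType) (n : nat) (A : set 'rV[R]_n) : \bar R :=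
  limf_esup (fun d : R => lne (covering_number A d) * ((- ln d)^-1)%:E)%E 0^'+.

Definition sub_self_similar (R : realType) (n N : nat)
    (f : 'I_N -> 'rV[R]_n -> 'rV[R]_n) (E : set 'rV[R]_n) : Prop :=
  [/\ E !=set0, compact E & E `<=` \bigcup_(i in [set: 'I_N]) (f i @` E)].

(* Letters and positions are numbered from 0: the sequence w_1 w_2 ... is the
   function k |-> w_(k+1). *)
Definition code_space (N : nat) : topologicalType :=
  prod_topology (fun _ : nat => discrete_topology 'I_N).

Definition left_shift (N : nat) (w : code_space N) : code_space N :=
  fun k => w k.+1.

Definition shift_closed (N : nat) (S : set (code_space N)) : Prop :=
  forall w, S w -> S (left_shift w).

Definition prefix_of (N : nat) (w : code_space N) (m : nat) : seq 'I_N :=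
  mkseq w m.

Definition prefixes (N : nat) (S : set (code_space N)) (m : nat) :
    set (seq 'I_N) :=
  [set prefix_of w m | w in S].

Definition all_prefixes (N : nat) (S : set (code_space N)) : set (seq 'I_N) :=
  \bigcup_(m in [set m | (1 <= m)%N]) prefixes S m.

Definition word_map (R : realType) (n N : nat)
    (f : 'I_N -> 'rV[R]_n -> 'rV[R]_n) (u : seq 'I_N) : 'rV[R]_n -> 'rV[R]_n :=
  foldr (fun i g => f i \o g) id u.

Definition word_ratio (R : realType) (N : nat) (rho : 'I_N -> R)
    (u : seq 'I_N) : R :=
  \prod_(i <- u) rho i.

(* For contractions the limit does not depend on the base point, taken to be 0
   here. *)
Definition coding_map (R : realType) (n N : nat)
    (f : 'I_N -> 'rV[R]_n -> 'rV[R]_n) (w : code_space N) : 'rV[R]_n :=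
  lim ((fun m : nat => word_map f (prefix_of w m) 0) @ \oo).

(* The inner sum ranges over the finite set of length-[k] prefixes, each
   counted once. *)
Definition tau (R : realType) (N : nat) (rho : 'I_N -> R)
    (S : set (code_space N)) (s : R) : R :=
  lim ((fun k : nat =>
    (\sum_(u \in prefixes S k) word_ratio rho u `^ s) `^ (k%:R^-1)) @ \oo).

Definition orbital_set (R : realType) (n N : nat)
    (f : 'I_N -> 'rV[R]_n -> 'rV[R]_n) (S : set (code_space N))
    (C : set 'rV[R]_n) : set 'rV[R]_n :=
  C `|` \bigcup_(u in all_prefixes S) (word_map f u @` C).

(* Main.v *)
(* Only the upper bound needs work. Let t > max(s, dim C). Choose r such that
   the closed Euclidean ball of radius r about 0 contains C and is mapped into
   itself by every f_i, and put D = 2 r. Given 0 < d < D, cut each sequence of S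
   at its first prefix v with rho_v D <= d. A point coded by the sequence, or a
   point of f_u(C) with u extending v, lies in the image under f_v of the ball,
   which has diameter at most d; since d < rho_v D / rho_min, this single set
   costs at most (D / rho_min)^t d^(-t) rho_v^t. The remaining sets f_u(C) have
   rho_u D > d, and rescaling a cover of C at scale d / rho_u <= D covers them by
   at most c d^(-t) rho_u^t sets. Since tau(s) = 1 and t > s, the sum of rho_u^t
   over all prefixes u of S converges geometrically, so E_C is covered by a
   constant times d^(-t) sets of diameter d. *)

Require Import Defs.
From HB Require Import structures.
From mathcomp Require Import all_boot all_order all_algebra.
From mathcomp Require Import all_classical all_reals all_analysis.
From mathcomp Require Import ring lra.

Import Order.TTheory GRing.Theory Num.Theory.
Import numFieldNormedType.Exports.

Local Open Scope classical_set_scope.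
Local Open Scope ring_scope.

Set Implicit Arguments.
Unset Strict Implicit.
Unset Printing Implicit Defensive.

(** * Euclidean norm and its comparison with the sup norm *)

(** Cauchy-Schwarz by Lagrange's identity: the double sum of the squares
    [(a i * b j - a j * b i) ^+ 2] is twice the difference of the two sides. *)
Lemma sum_mul_sqr_le (R : realType) (I : finType) (a b : I -> R) :
  (\sum_i a i * b i) ^+ 2 <= (\sum_i a i ^+ 2) * (\sum_i b i ^+ 2).
Proof.
have : 0 <= \sum_i \sum_j (a i * b j - a j * b i) ^+ 2.
  by do 2!apply: sumr_ge0 => ? _; exact: sqr_ge0.
suff -> : \sum_i \sum_j (a i * b j - a j * b i) ^+ 2 =
    ((\sum_i a i ^+ 2) * (\sum_i b i ^+ 2) - (\sum_i a i * b i) ^+ 2) *+ 2.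
  by rewrite pmulrn_lge0// subr_ge0.
transitivity (\sum_i \sum_j (a i ^+ 2 * b j ^+ 2 + b i ^+ 2 * a j ^+ 2
    - ((a i * b i) * (a j * b j)) *+ 2)).
  by do 2!(apply: eq_bigr => ? _); ring.
under eq_bigr do rewrite sumrB big_split/= -!mulr_sumr sumrMnl -mulr_sumr.
by rewrite sumrB big_split/= sumrMnl -!mulr_suml; ring.
Qed.

Lemma euclid_norm_ge0 (R : realType) (n : nat) (x : 'rV[R]_n) :
  0 <= euclid_norm x.
Proof. exact: sqrtr_ge0. Qed.

Lemma euclid_normN (R : realType) (n : nat) (x : 'rV[R]_n) :
  euclid_norm (- x) = euclid_norm x.
Proof. by congr Num.sqrt; apply: eq_bigr => i _; rewrite mxE sqrrN. Qed.

Lemma euclid_normD (R : realType) (n : nat) (x y : 'rV[R]_n) :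
  euclid_norm (x + y) <= euclid_norm x + euclid_norm y.
Proof.
rewrite -(@ler_pXn2r _ 2)// ?nnegrE ?addr_ge0 ?euclid_norm_ge0//.
rewrite sqrrD !sqr_sqrtr; do ?by apply: sumr_ge0 => i _; exact: sqr_ge0.
under eq_bigr do rewrite mxE sqrrD.
rewrite !big_split/= lerD2r lerD2l -mulr2n lerMn2r/=.
rewrite -sqrtrM; last by apply: sumr_ge0 => i _; exact: sqr_ge0.
by rewrite (le_trans (ler_norm _))// -sqrtr_sqr ler_wsqrtr// sum_mul_sqr_le.
Qed.

Lemma euclid_norm_triangle (R : realType) (n : nat) (y x z : 'rV[R]_n) :
  euclid_norm (x - z) <= euclid_norm (x - y) + euclid_norm (y - z).
Proof. by rewrite (le_trans _ (euclid_normD _ _))// addrA subrK. Qed.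

Lemma norm_le_euclid_norm (R : realType) (n : nat) (x : 'rV[R]_n) :
  `|x| <= euclid_norm x.
Proof.
rewrite [leLHS]/Num.Def.normr/= mx_normrE.
apply: bigmax_le; first exact: euclid_norm_ge0.
case=> i j _ /=; rewrite ord1 -sqrtr_sqr ler_wsqrtr//.
by rewrite (bigD1 j)//= lerDl; apply: sumr_ge0 => k _; exact: sqr_ge0.
Qed.

(** Each coordinate is at most the sup norm, so the sum of squares is at most [n * |x| ^+ 2]. The
    cruder factor [n.+1] avoids a root and stays positive for [n = 0], so that it can be divided
    by. *)
Lemma euclid_norm_le_norm (R : realType) (n : nat) (x : 'rV[R]_n) :
  euclid_norm x <= n.+1%:R * `|x|.
Proof.
rewrite -(@ler_pXn2r _ 2)// ?nnegrE ?mulr_ge0 ?euclid_norm_ge0//.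
rewrite sqr_sqrtr; last by apply: sumr_ge0 => i _; exact: sqr_ge0.
apply: (@le_trans _ _ (\sum_(i < n) `|x| ^+ 2)).
  apply: ler_sum => i _; rewrite -real_normK ?num_real// ler_sqr ?nnegrE//.
  rewrite [leRHS]/Num.Def.normr/= mx_normrE.
  exact: (le_bigmax _ (fun ij : 'I_1 * 'I_n => `|x ij.1 ij.2|) (0, i)).
rewrite sumr_const card_ord -[leLHS]mulr_natl exprMn ler_wpM2r// ?sqr_ge0//.
rewrite -natrX ler_nat expnS expn1.
exact: leq_trans (leqnSn n) (leq_pmulr _ _).
Qed.

(** * Calculus of finite covers *)

(* [x] is a real upper bound for the number of sets used. *)
Definition coverable (R : realType) (n : nat) (A : set 'rV[R]_n) (d x : R) :=
  exists2 k : nat, k%:R <= x & exists U : 'I_k -> set 'rV[R]_n,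
    (forall i, diam_le (U i) d) /\ A `<=` \bigcup_(i in [set: 'I_k]) U i.

Lemma coverable_le (R : realType) (n : nat) (A B : set 'rV[R]_n) (d x y : R) :
  A `<=` B -> x <= y -> coverable B d x -> coverable A d y.
Proof.
move=> AB xy [k kx [U [dU BU]]]; exists k; first exact: le_trans xy.
by exists U; split=> //; apply: subset_trans BU.
Qed.

Lemma coverable_diam (R : realType) (n : nat) (A : set 'rV[R]_n) (d e x : R) :
  d <= e -> coverable A d x -> coverable A e x.
Proof.
move=> de [k kx [U [dU AU]]]; exists k => //; exists U; split=> // i p q Up Uq.
exact: le_trans (dU _ _ _ Up Uq) de.
Qed.

Lemma coverable0 (R : realType) (n : nat) (d : R) :
  coverable (set0 : set 'rV[R]_n) d 0.
Proof. by exists 0%N => //; exists (fun=> set0); split=> [[]|]. Qed.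

Lemma coverable1 (R : realType) (n : nat) (A : set 'rV[R]_n) (d : R) :
  diam_le A d -> coverable A d 1.
Proof.
by move=> dA; exists 1%N => //; exists (fun=> A); split=> // p Ap; exists ord0.
Qed.

Lemma coverableU (R : realType) (n : nat) (A B : set 'rV[R]_n) (d x y : R) :
  coverable A d x -> coverable B d y ->
  coverable (A `|` B) d (x + y).
Proof.
move=> [k kx [U [dU AU]]] [l ly [V [dV BV]]].
exists (k + l)%N; first by rewrite natrD lerD.
exists (fun i : 'I_(k + l) => match fintype.split i with inl j => U j | inr j => V j end).
split=> [i|p [/AU[j _ Ujp]|/BV[j _ Vjp]]].
- by case: fintype.split.
- exists (lshift l j) => //.
  by have -> : fintype.split (lshift l j) = inl j := unsplitK (inl j).
- exists (rshift k j) => //.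
  by have -> : fintype.split (rshift k j) = inr j := unsplitK (inr j).
Qed.

Lemma coverable_bigcup (R : realType) (n : nat) (T : eqType) (s : seq T)
    (A : T -> set 'rV[R]_n) (d : R) (x : T -> R) :
  {in s, forall u, coverable (A u) d (x u)} ->
  coverable (\bigcup_(u in [set` s]) A u) d (\sum_(u <- s) x u).
Proof.
elim: s => [_|u s IH cA].
  by rewrite big_nil; apply: coverable_le (coverable0 _ _) => // p [].
rewrite big_cons.
apply: (@coverable_le _ _ _ (A u `|` \bigcup_(v in [set` s]) A v)) (lexx _) _.
  move=> p [v /=]; rewrite in_cons => /predU1P[-> Ap|vs Ap]; first by left.
  by right; exists v.
apply: coverableU; first by apply: cA; rewrite mem_head.
by apply: IH => v vs; apply: cA; rewrite in_cons vs orbT.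
Qed.

Lemma coverable_image (R : realType) (n : nat) (r : R)
    (f : 'rV[R]_n -> 'rV[R]_n) (A : set 'rV[R]_n) (d x : R) : 0 <= r ->
  is_similarity r f ->
  coverable A d x -> coverable (f @` A) (r * d) x.
Proof.
move=> r0 fr [k kx [U [dU AU]]]; exists k => //; exists (fun i => f @` U i).
split=> [i _ _ [p Up <-] [q Uq <-]|_ [p /AU[i _ Up] <-]].
  by rewrite fr ler_wpM2l// (dU i).
by exists i => //; exists p.
Qed.

(** * Covering numbers and upper box dimension *)

Lemma covering_number_ge0 (R : realType) (n : nat) (A : set 'rV[R]_n) (d : R) :
  (0 <= covering_number A d)%E.
Proof. by apply: le_ereal_inf_tmp => _ [k _ <-]; rewrite lee_fin. Qed.

Lemma covering_number_le (R : realType) (n : nat) (A : set 'rV[R]_n) (d x : R) :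
  coverable A d x -> (covering_number A d <= x%:E)%E.
Proof.
move=> [k kx cA]; apply: (@le_trans _ _ (k%:R)%:E); last by rewrite lee_fin.
by apply: ereal_inf_lbound; exists k.
Qed.

Lemma covering_number_lt (R : realType) (n : nat) (A : set 'rV[R]_n) (d x : R) :
  (covering_number A d < x%:E)%E -> coverable A d x.
Proof.
by move=> /ereal_inf_lt[_ [k cA <-]]; rewrite lte_fin => /ltW kx; exists k.
Qed.

Lemma covering_number_sub (R : realType) (n : nat) (A B : set 'rV[R]_n)
    (d : R) :
  A `<=` B -> (covering_number A d <= covering_number B d)%E.
Proof.
move=> AB; apply: le_ereal_inf => _ [k [U [dU BU]] <-]; exists k => //.
by exists U; split=> //; apply: subset_trans BU.
Qed.

Lemma lne_covering_number_le (R : realType) (n : nat) (A : set 'rV[R]_n)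
    (d : R) (y : \bar R) : (0 <= y)%E ->
  (covering_number A d <= y)%E -> (lne (covering_number A d) <= lne y)%E.
Proof.
move=> y0 Ay; rewrite lee_lne// in_itv/= ?leey ?andbT//.
exact: covering_number_ge0.
Qed.

Lemma near_at_right0 (R : realType) (V : set R) :
  (0 : R)^'+ V -> exists2 e : R, 0 < e & forall d, 0 < d < e -> V d.
Proof.
move=> /nbhs_ballP[e /= e0 eV]; exists e => // d /andP[d0 de].
by apply: eV => //; rewrite /ball/= sub0r normrN gtr0_norm.
Qed.

Lemma at_right0_itv (R : realType) (e : R) :
  0 < e -> (0 : R)^'+ [set d | 0 < d < e].
Proof.
move=> e0; apply/nbhs_ballP; exists e => //= d.
rewrite /ball/= sub0r normrN => de d0; rewrite d0/=.
exact: le_lt_trans (ler_norm _) de.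
Qed.

Lemma upper_box_dim_sub (R : realType) (n : nat) (A B : set 'rV[R]_n) :
  A `<=` B -> (upper_box_dim A <= upper_box_dim B)%E.
Proof.
move=> AB; apply: le_ereal_inf_tmp => _ [V V0 <-].
apply: ge_ereal_inf; eexists.
  (* For [d < 1] the factor [(- ln d)^-1] is nonnegative, so multiplying by it preserves the
     order. *)
  exists (V `&` [set d | 0 < d < 1]) => //.
  by apply: filterI => //; exact: at_right0_itv.
apply: ub_ereal_sup => _ [d [Vd /andP[d0 d1]] <-].
apply: (@le_trans _ _ (lne (covering_number B d) * ((- ln d)^-1)%:E)%E).
  apply: lee_wpmul2r; first by rewrite lee_fin invr_ge0 oppr_ge0 ln_le0// ltW.
  apply: lne_covering_number_le; first exact: covering_number_ge0.
  exact: covering_number_sub.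
by apply: ereal_sup_ubound; exists d.
Qed.

(** The limsup is an infimum of suprema over neighbourhoods, so some neighbourhood has its supremum
    below [t]. Strictness then yields an actual cover with at most [d^(-t)] sets. *)
Lemma upper_box_dim_lt (R : realType) (n : nat) (A : set 'rV[R]_n) (t : R) :
  (upper_box_dim A < t%:E)%E ->
  exists2 e : R, 0 < e & forall d, 0 < d < e -> coverable A d (d `^ (- t)).
Proof.
move=> /ereal_inf_lt[_ [V /near_at_right0[e e0 eV] <-] supV].
exists (Num.min e 1); first by rewrite lt_min e0 ltr01.
move=> d /andP[d0]; rewrite lt_min => /andP[de d1].
apply: covering_number_lt; rewrite ltNge; apply/negP => tA.
move: supV; apply/negP; rewrite -leNgt.
have lnd : 0 < - ln d by rewrite oppr_gt0 ln_lt0// d0.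
apply: (@le_trans _ _ (lne (covering_number A d) * ((- ln d)^-1)%:E)%E).
  (* Here [t] is rewritten as [ln (d^(-t)) / (- ln d)], to be compared with the quotient that
     defines the dimension. *)
  rewrite -[t](mulfK (lt0r_neq0 lnd)) EFinM; apply: lee_wpmul2r.
    by rewrite lee_fin invr_ge0 ltW.
  have td : 0 < d `^ (- t) by rewrite powR_gt0.
  rewrite mulrN -mulNr -ln_powR -lne_EFin//.
  rewrite lee_lne// in_itv/= leey andbT ?lee_fin ?(ltW td)//.
  exact: covering_number_ge0.
by apply: ereal_sup_ubound; exists d => //; apply: eV; rewrite d0.
Qed.

Lemma upper_box_dim_le (R : realType) (n : nat) (A : set 'rV[R]_n) (t e : R) :
  0 < e -> (forall d, 0 < d < e -> coverable A d (d `^ (- t))) ->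
  (upper_box_dim A <= t%:E)%E.
Proof.
move=> e0 cA; apply: ge_ereal_inf; eexists.
  exists [set d | 0 < d < Num.min e 1] => //.
  by apply: at_right0_itv; rewrite lt_min e0 ltr01.
apply: ub_ereal_sup => _ [d /andP[d0 dm] <-].
move: dm; rewrite lt_min => /andP[de d1].
have lnd : 0 < - ln d by rewrite oppr_gt0 ln_lt0// d0.
have td : 0 < d `^ (- t) by rewrite powR_gt0.
rewrite -[t](mulfK (lt0r_neq0 lnd)) EFinM; apply: lee_wpmul2r.
  by rewrite lee_fin invr_ge0 ltW.
rewrite mulrN -mulNr -ln_powR -lne_EFin//; apply: lne_covering_number_le.
  by rewrite lee_fin ltW.
by apply: covering_number_le; apply: cA; rewrite d0.
Qed.

(** For every [h > 0] the constant [M] is at most [d^(-h)] once [d] is small, so it costs only [h]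
    in the exponent. *)
Lemma upper_box_dim_le_const (R : realType) (n : nat) (A : set 'rV[R]_n)
    (M t e : R) : 0 < e ->
  (forall d, 0 < d < e -> coverable A d (M * d `^ (- t))) ->
  (upper_box_dim A <= t%:E)%E.
Proof.
move=> e0 cA; apply/lee_addgt0Pr => h h0.
pose K := Num.max M 1.
have K0 : 0 < K by rewrite lt_max ltr01 orbT.
(* The second bound on [d] is the solution of [d^(-h) = K]; the maximum with 1 makes [K] positive
   whatever the sign of [M]. *)
apply: (@upper_box_dim_le _ _ _ _ (Num.min e (K^-1 `^ h^-1))).
  by rewrite lt_min e0 powR_gt0 ?invr_gt0.
move=> d /andP[d0]; rewrite lt_min => /andP[de dK].
apply: coverable_le (cA d _); rewrite ?d0//.
rewrite opprD powRD; last by rewrite (lt0r_neq0 d0) implybT.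
rewrite mulrC ler_wpM2l ?powR_ge0//.
apply: (@le_trans _ _ K); first by rewrite le_max lexx.
rewrite powRN -[leLHS]invrK lef_pV2 ?posrE ?invr_gt0 ?powR_gt0//.
rewrite -[leRHS]powRr1 ?invr_ge0 ?(ltW K0)// -(mulVf (lt0r_neq0 h0)) powRrM.
by rewrite ge0_ler_powR ?nnegrE ?(ltW h0) ?powR_ge0 ?(ltW d0) ?(ltW dK).
Qed.

(** * Words, their ratios and the prefixes of [S] *)

Lemma word_map_cat (R : realType) (n N : nat)
    (f : 'I_N -> 'rV[R]_n -> 'rV[R]_n) (u v : seq 'I_N) :
  word_map f (u ++ v) = word_map f u \o word_map f v.
Proof. by elim: u => //= i u ->. Qed.

Lemma word_map_similarity (R : realType) (n N : nat)
    (f : 'I_N -> 'rV[R]_n -> 'rV[R]_n) (rho : 'I_N -> R) (u : seq 'I_N) :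
  (forall i, is_similarity (rho i) (f i)) ->
  is_similarity (word_ratio rho u) (word_map f u).
Proof.
move=> f_sim; rewrite /word_ratio; elim: u => [|i u IH] x y /=.
  by rewrite big_nil mul1r.
by rewrite big_cons f_sim IH mulrA.
Qed.

Lemma word_ratio_gt0 (R : realType) (N : nat) (rho : 'I_N -> R)
    (u : seq 'I_N) : (forall i, 0 < rho i) -> 0 < word_ratio rho u.
Proof. by move=> rho0; apply: prodr_gt0. Qed.

Lemma word_ratio_rcons (R : realType) (N : nat) (rho : 'I_N -> R)
    (u : seq 'I_N) (i : 'I_N) :
  word_ratio rho (rcons u i) = word_ratio rho u * rho i.
Proof. by rewrite /word_ratio big_rcons/= mulrC. Qed.

Lemma word_ratio_le (R : realType) (N : nat) (rho : 'I_N -> R) (q : R)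
    (u : seq 'I_N) :
  (forall i, 0 < rho i <= q) -> word_ratio rho u <= q ^+ size u.
Proof.
move=> rhoq; elim: u => [|i u IH]; first by rewrite /word_ratio big_nil.
rewrite /word_ratio big_cons exprS; have /andP[rho0 rhoi] := rhoq i.
apply: ler_pM => //; first exact: ltW.
by apply/ltW/word_ratio_gt0 => j; have /andP[] := rhoq j.
Qed.

Lemma prefix_ofD (N : nat) (w : code_space N) (m k : nat) :
  exists u, prefix_of w (m + k) = prefix_of w m ++ u.
Proof. by exists (map w (iota m k)); rewrite /prefix_of /mkseq iotaD map_cat. Qed.

Lemma prefix_ofS (N : nat) (w : code_space N) (m : nat) :
  prefix_of w m.+1 = rcons (prefix_of w m) (w m).
Proof. by rewrite /prefix_of mkseqS. Qed.

Lemma finite_prefixes (N : nat) (S : set (code_space N)) (k : nat) :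
  finite_set (prefixes S k).
Proof.
apply: (@sub_finite_set _ _ (@tval k 'I_N @` [set: k.-tuple 'I_N])).
  move=> _ [w _ <-]; have wk : size (prefix_of w k) == k by rewrite size_mkseq.
  by exists (Tuple wk).
exact/finite_image/finite_finset.
Qed.

(** A duplicate-free enumeration, so that sums over it agree with the finitely supported sums in
    [tau]. *)
Definition prefix_seq (N : nat) (S : set (code_space N)) (k : nat) :
    seq (seq 'I_N) :=
  finmap.enum_fset (fset_set (prefixes S k)).

Lemma mem_prefix_seq (N : nat) (S : set (code_space N)) (k : nat)
    (u : seq 'I_N) : u \in prefix_seq S k <-> prefixes S k u.
Proof.
have -> : (u \in prefix_seq S k) = (u \in prefixes S k).
  by rewrite -(in_fset_set (finite_prefixes S k)).
by split; [rewrite inE | rewrite inE].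
Qed.

(** * Distance from coded points to the images of the origin *)

Lemma euclid_norm_word_map (R : realType) (n N : nat)
    (f : 'I_N -> 'rV[R]_n -> 'rV[R]_n) (r : R) (u : seq 'I_N) (x : 'rV[R]_n) :
  (forall i y, euclid_norm y <= r -> euclid_norm (f i y) <= r) ->
  euclid_norm x <= r -> euclid_norm (word_map f u x) <= r.
Proof. by move=> f_ball xr; elim: u => //= i u; exact: f_ball. Qed.

(** The longer word is the prefix of length [m] followed by some [u]; [f_u] keeps [x] in the
    invariant ball and the prefix scales distances to the origin. A general [x] serves both the base
    point 0 and the points of [C]. *)
Lemma word_map_dist (R : realType) (n N : nat)
    (f : 'I_N -> 'rV[R]_n -> 'rV[R]_n) (rho : 'I_N -> R) (r : R)
    (w : code_space N) (m k : nat) (x : 'rV[R]_n) :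
  (forall i, 0 < rho i) -> (forall i, is_similarity (rho i) (f i)) ->
  (forall i y, euclid_norm y <= r -> euclid_norm (f i y) <= r) ->
  euclid_norm x <= r -> (m <= k)%N ->
  euclid_norm (word_map f (prefix_of w k) x - word_map f (prefix_of w m) 0)
    <= word_ratio rho (prefix_of w m) * r.
Proof.
move=> rho0 f_sim f_ball xr mk; rewrite -(subnKC mk).
have [u ->] := prefix_ofD w m (k - m).
rewrite word_map_cat/= (word_map_similarity _ f_sim).
rewrite ler_wpM2l ?(ltW (word_ratio_gt0 _ _))// subr0.
exact: euclid_norm_word_map.
Qed.

(** The images of 0 form a Cauchy sequence, since the ratios of the prefixes decay like [q ^+ k];
    the bound of [word_map_dist] then passes to the limit. *)
Lemma coding_map_dist (R : realType) (n N : nat)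
    (f : 'I_N -> 'rV[R]_n -> 'rV[R]_n) (rho : 'I_N -> R) (q r : R)
    (w : code_space N) (m : nat) : 0 <= q < 1 -> 0 <= r ->
  (forall i, 0 < rho i <= q) -> (forall i, is_similarity (rho i) (f i)) ->
  (forall i y, euclid_norm y <= r -> euclid_norm (f i y) <= r) ->
  euclid_norm (coding_map f w - word_map f (prefix_of w m) 0)
    <= word_ratio rho (prefix_of w m) * r.
Proof.
move=> /andP[q0 q1] r0 rhoq f_sim f_ball.
have rho0 i : 0 < rho i by have /andP[] := rhoq i.
have x0 : euclid_norm (0 : 'rV[R]_n) <= r.
  by rewrite (le_trans (euclid_norm_le_norm _))// normr0 mulr0.
pose y k := word_map f (prefix_of w k) 0.
have y_dist j k : (j <= k)%N ->
    euclid_norm (y k - y j) <= word_ratio rho (prefix_of w j) * r.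
  exact: word_map_dist.
have y_cvg : cvg (y @ \oo).
  apply: cauchy_cvg; apply: cauchy_exP => e e0.
  have qr : q ^+ k * r @[k --> \oo] --> 0 * r.
    by apply: cvgMl; apply: cvg_expr; rewrite ger0_norm.
  have /cvgr_lt/(_ e) := qr; rewrite mul0r => /(_ e0)[K _ qK].
  exists (y K); exists K => // k /= Kk.
  rewrite -ball_normE/= distrC; apply: le_lt_trans (qK K (leqnn K)).
  apply: le_trans (norm_le_euclid_norm _) _.
  apply: le_trans (y_dist _ _ Kk) _; rewrite ler_wpM2r//.
  by rewrite -[X in q ^+ X](size_mkseq w K); exact: word_ratio_le.
apply/ler_addgt0Pr => e e0.
(* Convergence holds in the sup norm; the division by [n.+1] pays for the return to the Euclidean
   norm. *)
have en0 : 0 < e / n.+1%:R by rewrite divr_gt0.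
have /cvgrPdist_lt/(_ _ en0)[K _ yK] := y_cvg.
have := yK (maxn K m) (leq_maxl _ _).
rewrite /= ltr_pdivlMr// mulrC => /ltW yKm.
apply: le_trans (euclid_norm_triangle (y (maxn K m)) _ _) _.
rewrite addrC lerD//; first exact/y_dist/leq_maxr.
exact: le_trans (euclid_norm_le_norm _) yKm.
Qed.

(** * Boundedness of the sum over all prefixes *)

Lemma sum_le_geometric (R : realType) (b : nat -> R) (c : R) (K : nat) :
  0 <= c < 1 -> (forall k, 0 <= b k) -> (forall k, (K <= k)%N -> b k <= c ^+ k) ->
  exists Z, forall L, \sum_(0 <= k < L) b k <= Z.
Proof.
move=> /andP[c0 c1] b0 bc.
exists (\sum_(0 <= k < K) b k + (1 - c)^-1) => L.
apply: (@le_trans _ _ (\sum_(0 <= k < K + L) b k)).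
  by rewrite addnC [leRHS](@big_cat_nat _ _ _ L 0)//= ?leq_addr// lerDl sumr_ge0.
rewrite (@big_cat_nat _ _ _ K 0)//= ?leq_addr// lerD2l.
apply: (@le_trans _ _ (\sum_(i < L) c ^+ i)).
  (* After the shift by [K] the term at [i] is at most [c ^+ (i + K)], hence at most [c ^+ i]. *)
  rewrite -{1}[K]add0n big_addn addKn big_mkord; apply: ler_sum => i _.
  rewrite (le_trans (bc _ (leq_addl _ _)))//.
  by rewrite ler_wiXn2l ?leq_addr// ltW.
rewrite -[leRHS]mul1r ler_pdivlMr ?subr_gt0// mulrC.
have := subrX1 c L; rewrite -[1 - c]opprB mulNr => <-.
by rewrite opprB gerBl exprn_ge0.
Qed.

(** On words of length [k], [rho_u^t] is at most [q^(k (t - s)) rho_u^s]. The sum at level [k] is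
    thus at most [x ^+ k * a k], whose [k]-th root tends to [x < 1]. *)
Lemma word_ratio_sum_bounded (R : realType) (N : nat) (rho : 'I_N -> R)
    (S : set (code_space N)) (q s t : R) :
  0 < q < 1 -> (forall i, 0 < rho i <= q) -> tau rho S s = 1 -> s < t ->
  exists Z, forall L, \sum_(0 <= k < L)
    \sum_(u <- prefix_seq S k) word_ratio rho u `^ t <= Z.
Proof.
move=> /andP[q0 q1] rhoq tau_s st.
have rho0 i : 0 < rho i by have /andP[] := rhoq i.
pose a k : R := \sum_(u <- prefix_seq S k) word_ratio rho u `^ s.
have a_ge0 k : 0 <= a k by apply: sumr_ge0 => u _; exact: powR_ge0.
(* A divergent sequence has the junk limit 0, so [tau_s] implies convergence. *)
have a_cvg : a k `^ k%:R^-1 @[k --> \oo] --> (1 : R).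
  have aE : (fun k : nat => (\sum_(u \in prefixes S k) word_ratio rho u `^ s)
      `^ k%:R^-1) = (fun k => a k `^ k%:R^-1).
    by apply/funext => k; rewrite fsbig_finite//; exact: finite_prefixes.
  rewrite /tau aE in tau_s.
  have [|/dvgP] := pselect (cvg (a k `^ k%:R^-1 @[k --> \oo])); first by rewrite tau_s.
  rewrite tau_s => /eqP; rewrite /point/=.
  by rewrite oner_eq0.
pose x := q `^ (t - s).
have x0 : 0 < x by exact: powR_gt0.
have x1 : x < 1.
  have -> : 1 = 1 `^ (t - s) :> R by rewrite powR1.
  by apply: gt0_ltr_powR; rewrite ?nnegrE ?subr_gt0 ?(ltW q0) ?ler01.
(* This threshold exceeds 1 because [x < 1]; below it, [x] times the [k]-th root of [a k] is less
   than [(1 + x) / 2], the midpoint of [x] and 1. *)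
have := cvgr_lt _ a_cvg ((1 + x) / 2 / x).
case; first by rewrite ltr_pdivlMr// mul1r; lra.
move=> K _ aK.
(* Starting at [K.+1] forces [k > 0], so that [a k] is the [k]-th power of its [k]-th root. *)
apply: (@sum_le_geometric _ _ ((1 + x) / 2) K.+1).
- by apply/andP; split; lra.
- by move=> k; apply: sumr_ge0 => u _; exact: powR_ge0.
move=> k Kk.
have k0 : (0 < k)%N by exact: leq_ltn_trans Kk.
apply: (@le_trans _ _ (x ^+ k * a k)).
  rewrite mulr_sumr !big_seq; apply: ler_sum => u.
  move=> /mem_prefix_seq[w Sw uE].
  have u0 := word_ratio_gt0 u rho0.
  rewrite -[t in leLHS](subrK s) powRD; last by rewrite (lt0r_neq0 u0) implybT.
  rewrite ler_wpM2r ?powR_ge0// -powR_mulrn ?(ltW x0)//.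
  rewrite -powRrM mulrC powRrM powR_mulrn ?(ltW q0)//.
  apply: ge0_ler_powR; rewrite ?nnegrE ?subr_ge0 ?(ltW st) ?(ltW u0) ?exprn_ge0 ?(ltW q0)//.
  have := word_ratio_le u rhoq.
  by rewrite -{2}uE size_mkseq.
have /ltW := aK k (ltnW Kk).
rewrite /= ler_pdivlMr// => aKk.
have -> : a k = (a k `^ k%:R^-1) ^+ k.
  by rewrite -powR_mulrn ?powR_ge0// -powRrM mulVf ?powRr1// pnatr_eq0 -lt0n.
rewrite -exprMn lerXn2r ?nnegrE ?mulr_ge0 ?powR_ge0 ?(ltW x0)//; first lra.
by rewrite mulrC.
Qed.

(** * Uniform constants: scales, ratios, invariant ball, cutting length *)

Lemma powRN_le (R : realType) (x y t : R) :
  0 <= t -> 0 < x -> x <= y -> y `^ (- t) <= x `^ (- t).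
Proof.
move=> t0 x0 xy; have y0 := lt_le_trans x0 xy.
rewrite !powRN lef_pV2 ?posrE ?powR_gt0//.
by apply: ge0_ler_powR; rewrite ?nnegrE// ltW.
Qed.

(** For [d >= e / 2] the cover at scale [e / 2] is reused; its size is bounded independently of [d],
    while [d^(-t)] is at least [D^(-t)]. *)
Lemma coverable_scales (R : realType) (n : nat) (A : set 'rV[R]_n)
    (e t D : R) : 0 < e -> 0 <= t -> 0 < D ->
  (forall d, 0 < d < e -> coverable A d (d `^ (- t))) ->
  exists2 c, 0 <= c & forall d, 0 < d <= D -> coverable A d (c * d `^ (- t)).
Proof.
move=> e0 t0 D0 cA; have he : 0 < e / 2 < e by apply/andP; split; lra.
have /andP[he0 he1] := he.
(* Chosen so that [c * D^(-t)] equals the bound at scale [e / 2]. *)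
pose c := (e / 2) `^ (- t) * D `^ t.
have c0 : 0 <= c by rewrite mulr_ge0 ?powR_ge0.
exists (1 + c) => [|d /andP[d0 dD]]; first by rewrite addr_ge0.
have [de|de] := ltP d (e / 2).
  apply: coverable_le (cA d _) => //; last by rewrite d0 (lt_trans de).
  by rewrite ler_peMl ?powR_ge0// lerDl.
apply: coverable_diam de _; apply: coverable_le (cA _ he) => //.
apply: (@le_trans _ _ (c * D `^ (- t))).
  by rewrite /c -mulrA (powRN D) mulfV ?mulr1// lt0r_neq0 ?powR_gt0.
by rewrite ler_pM ?powR_ge0 ?powRN_le// lerDr.
Qed.

Lemma contraction_ratio_bounds (R : realType) (N : nat) (rho : 'I_N -> R) :
  (forall i, 0 < rho i /\ rho i < 1) ->
  exists p q, [/\ 0 < p, forall i, p <= rho i, 0 < q < 1 &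
    forall i, 0 < rho i <= q].
Proof.
move=> rho01.
(* The defaults 1 and 1/2 keep [p > 0] and [0 < q < 1] even for an empty family. *)
exists (\big[Num.min/1]_i rho i), (\big[Num.max/2^-1]_i rho i); split.
- by apply: lt_bigmin => // i _; have [] := rho01 i.
- by move=> i; exact: bigmin_le.
- apply/andP; split.
    by apply: lt_le_trans (bigmax_ge_id _ _ _ _); rewrite invr_gt0.
  by apply: bigmax_lt => [|i _]; [lra | have [] := rho01 i].
- by move=> i; have [-> _] := rho01 i; exact: le_bigmax.
Qed.

(** With [b] bounding the norms of all [f i 0], a ball of radius [r] is mapped into one of radius
    [q * r + b], which is at most [r] as soon as [r >= b / (1 - q)]. Adding [B] makes room for
    [C]. *)
Lemma invariant_ball (R : realType) (n N : nat)
    (f : 'I_N -> 'rV[R]_n -> 'rV[R]_n) (rho : 'I_N -> R) (q : R)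
    (C : set 'rV[R]_n) : 0 < q < 1 -> (forall i, 0 < rho i <= q) ->
  (forall i, is_similarity (rho i) (f i)) -> compact C ->
  exists r, [/\ 0 < r, forall x, C x -> euclid_norm x <= r &
    forall i y, euclid_norm y <= r -> euclid_norm (f i y) <= r].
Proof.
move=> /andP[q0 q1] rhoq f_sim /compact_bounded[M [_ CM]].
(* Boundedness provides every number above [M] as a sup norm bound on [C], hence the [+ 1]; the
   factor [n.+1] converts it to the Euclidean norm. *)
pose B : R := n.+1%:R * (`|M| + 1).
pose b : R := \sum_i euclid_norm (f i 0).
have b0 : 0 <= b by apply: sumr_ge0 => i _; exact: euclid_norm_ge0.
have B0 : 0 < B by rewrite mulr_gt0// ltr_wpDl.
have q1' : 0 < 1 - q by rewrite subr_gt0.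
have bq0 : 0 <= b / (1 - q) by rewrite divr_ge0// ltW.
exists (b / (1 - q) + B); split; first exact: ltr_wpDl.
  move=> x Cx; apply: le_trans (euclid_norm_le_norm x) _.
  rewrite ler_wpDl// ler_wpM2l// CM//.
  by apply: le_lt_trans (ler_norm M) _; rewrite ltrDl.
move=> i y yr; have /andP[rho0 rhoi] := rhoq i.
rewrite -[f i y](subrK (f i 0)) (le_trans (euclid_normD _ _))// f_sim subr0.
have fb : euclid_norm (f i 0) <= b.
  rewrite /b (bigD1 i)//= lerDl; apply: sumr_ge0 => j _.
  exact: euclid_norm_ge0.
apply: (@le_trans _ _ (q * (b / (1 - q) + B) + b)).
  apply: lerD => //; apply: ler_pM => //; first exact: ltW.
  exact: euclid_norm_ge0.
have bE : b / (1 - q) * (1 - q) = b by rewrite divfK// lt0r_neq0.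
have : 0 <= (1 - q) * B by rewrite mulr_ge0// ltW.
by move: (b / (1 - q)) bE => g <-; lra.
Qed.

(** The empty prefix is too large because [d < D]. The first prefix that is small extends one that
    is not by a single letter, which shrinks the ratio by a factor of at least [p]. *)
Lemma first_small_prefix (R : realType) (N : nat) (rho : 'I_N -> R)
    (w : code_space N) (p D d : R) (k : nat) :
  (forall i, 0 < rho i) -> (forall i, p <= rho i) -> 0 < p -> 0 < d < D ->
  word_ratio rho (prefix_of w k) * D <= d ->
  exists2 m, (m <= k)%N & word_ratio rho (prefix_of w m) * D <= d /\
    p * d < word_ratio rho (prefix_of w m) * D.
Proof.
move=> rho0 prho p0 /andP[d0 dD]; elim: k => [|k IH].
  by rewrite /word_ratio big_nil mul1r leNgt dD.
have [wk _|wk wk1] := leP (word_ratio rho (prefix_of w k) * D) d.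
  by have [m mk Hm] := IH wk; exists m => //; exact: leqW.
exists k.+1 => //; split=> //; rewrite prefix_ofS word_ratio_rcons.
rewrite [ltRHS]mulrAC [ltRHS]mulrC; apply: (@lt_le_trans _ _
  (p * (word_ratio rho (prefix_of w k) * D))); first by rewrite ltr_pM2l.
rewrite ler_wpM2r// mulr_ge0//; first exact/ltW/word_ratio_gt0.
exact/ltW/(lt_trans d0).
Qed.


(** * The cover of the orbital set and the dimension bounds *)

(** Every prefix [u] up to a fixed length receives one [piece], of cost at most a constant times
    [d^(-t) rho_u^t]. The total cost is then controlled by the sum over all prefixes. *)
Lemma coverable_orbit (R : realType) (n N : nat)
    (f : 'I_N -> 'rV[R]_n -> 'rV[R]_n) (rho : 'I_N -> R)
    (rho01 : forall i, 0 < rho i /\ rho i < 1)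
    (f_sim : forall i, is_similarity (rho i) (f i))
    (C : set 'rV[R]_n) (C_compact : compact C)
    (S : set (code_space N)) (s t e : R) :
  S !=set0 -> 0 <= s -> s < t -> tau rho S s = 1 -> 0 < e ->
  (forall d, 0 < d < e -> coverable C d (d `^ (- t))) ->
  exists M D, 0 < D /\ forall d, 0 < d < D ->
    coverable ((coding_map f @` S) `|` orbital_set f S C) d (M * d `^ (- t)).
Proof.
move=> S0 s0 st tau_s e0 cC.
have [p [q [p0 prho q01 rhoq]]] := contraction_ratio_bounds rho01.
have /andP[q0 q1] := q01.
have rho0 i : 0 < rho i by have [] := rho01 i.
have [r [r0 Cr f_ball]] := invariant_ball q01 rhoq f_sim C_compact.
have t0 : 0 <= t by rewrite (le_trans s0)// ltW.
pose D := 2 * r; have D0 : 0 < D by rewrite mulr_gt0.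
have [c c0 cCD] := coverable_scales e0 t0 D0 cC.
have [Z sumZ] := word_ratio_sum_bounded q01 rhoq tau_s st.
(* The two summands pay for the two kinds of nonempty piece: a rescaled cover of [C], and a single
   disk. *)
pose M := c + (D / p) `^ t.
exists (M * Z), D; split=> // d /andP[d0 dD].
(* This ball contains the image under [f_u] of the invariant ball, and also the points coded by
   extensions of [u], by [coding_map_dist]. *)
pose disk u := [set x | euclid_norm (x - word_map f u 0) <= word_ratio rho u * r].
pose piece u := if d < word_ratio rho u * D then word_map f u @` C
  else if p * d < word_ratio rho u * D then disk u else set0.
have piece_coverable u :
    coverable (piece u) d (M * d `^ (- t) * word_ratio rho u `^ t).
  have u0 := word_ratio_gt0 u rho0.
  rewrite /piece; case: ifPn => [du|]; last rewrite -leNgt => ud.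
    (* A cover of [C] at scale [d / rho_u] is transported by [f_u]; the case hypothesis says exactly
       that this scale is below [D]. *)
    rewrite [X in coverable _ X](_ : d = word_ratio rho u * (d / word_ratio rho u)).
      2: by rewrite mulrC divfK ?lt0r_neq0.
    apply: coverable_image (ltW u0) (word_map_similarity _ f_sim) _.
    apply: coverable_le (cCD _ _) => //; last first.
      by rewrite divr_gt0// ler_pdivrMr// mulrC ltW.
    rewrite powRM ?invr_ge0 ?(ltW d0) ?(ltW u0)//.
    rewrite -powR_inv1 ?(ltW u0)// -powRrM mulrNN mul1r mulrA.
    by rewrite ler_wpM2r ?powR_ge0// ler_wpM2r ?powR_ge0// lerDl powR_ge0.
  case: ifPn => [pu|_]; last first.
    apply: coverable_le (coverable0 _ _) => //.
    by rewrite !mulr_ge0 ?addr_ge0 ?powR_ge0.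
  (* A single set is affordable: [p * d < rho_u * D] gives [1 <= (D / p)^t rho_u^t d^(-t)]. *)
  apply: (@coverable_le _ _ _ (disk u) _ 1) => //; last apply: coverable1.
    rewrite powRN mulrAC ler_pdivlMr ?powR_gt0// mul1r.
    apply: (@le_trans _ _ ((D / p) `^ t * word_ratio rho u `^ t)).
      rewrite -powRM ?divr_ge0 ?(ltW D0) ?(ltW p0) ?(ltW u0)//.
      apply: ge0_ler_powR; rewrite ?nnegrE ?mulr_ge0 ?invr_ge0 ?(ltW r0) ?(ltW p0) ?(ltW u0) ?(ltW d0)//.
      by rewrite mulrAC ler_pdivlMr// mulrC [D * _]mulrC ltW.
    by rewrite ler_wpM2r ?powR_ge0// lerDr.
  move=> x y ux uy; apply: le_trans (euclid_norm_triangle (word_map f u 0) _ _) _.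
  apply: le_trans ud; rewrite -[word_map f u 0 - y]opprB euclid_normN.
  have -> : word_ratio rho u * D = word_ratio rho u * r + word_ratio rho u * r.
    by rewrite /D; ring.
  exact: lerD.
(* From length [L] on every prefix is small, so the lengths 0 to [L] suffice and the cover is
   finite. *)
have [L Ld] : exists L, forall k, (L <= k)%N -> q ^+ k * D <= d.
  have qD : q ^+ k * D @[k --> \oo] --> 0 * D.
    by apply: cvgMl; apply: cvg_expr; rewrite ger0_norm// ltW.
  have /cvgr_lt/(_ d) := qD; rewrite mul0r => /(_ d0)[L _ qL].
  by exists L => k Lk; apply: ltW; exact: qL.
have small w k : (L <= k)%N -> word_ratio rho (prefix_of w k) * D <= d.
  move=> Lk; apply: le_trans (Ld _ Lk); rewrite ler_wpM2r ?(ltW D0)//.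
  by have := word_ratio_le (prefix_of w k) rhoq; rewrite size_mkseq.
pose U := \bigcup_(k in [set` index_iota 0 L.+1])
  \bigcup_(u in [set` prefix_seq S k]) piece u.
have in_U w k x : S w -> (k <= L)%N -> piece (prefix_of w k) x -> U x.
  move=> Sw kL wx; exists k; first by rewrite /= mem_index_iota.
  by exists (prefix_of w k) => //=; apply/mem_prefix_seq; exists w.
have in_disk w k x : S w -> word_ratio rho (prefix_of w k) * D <= d ->
    (forall m, (m <= k)%N -> disk (prefix_of w m) x) -> U x.
  move=> Sw wk xw.
  have dd : 0 < d < D by rewrite d0.
  have [m mk [wm pwm]] := first_small_prefix rho0 prho p0 dd wk.
  have [mL|/ltnW Lm] := leqP m L.
    apply: (in_U w m) => //; rewrite /piece ltNge wm pwm/=; exact: xw.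
  (* When the cut lies beyond [L], cutting the prefix of length [L] gives another of admissible
     length; since [j <= L <= m <= k], the point lies in its disk too. *)
  have [j jL [wj pwj]] := first_small_prefix rho0 prho p0 dd (small w L (leqnn L)).
  apply: (in_U w j) => //; rewrite /piece ltNge wj pwj/=.
  exact/xw/(leq_trans jL)/(leq_trans Lm).
apply: (@coverable_le _ _ _ U _ (M * d `^ (- t) * \sum_(0 <= k < L.+1)
    \sum_(u <- prefix_seq S k) word_ratio rho u `^ t)).
- have q0' : 0 <= q < 1 by rewrite (ltW q0).
  have orbitU w k x : S w -> C x -> U (word_map f (prefix_of w k) x).
    move=> Sw Cx.
    have [wk|wk] := ltP d (word_ratio rho (prefix_of w k) * D).
      apply: (in_U w k) => //.
        by rewrite leqNgt; apply/negP => /ltnW/(small w); rewrite leNgt wk.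
      by rewrite /piece wk; exists x.
    apply: (in_disk w k) => // m mk.
    by apply: word_map_dist => //; exact: Cr.
  move=> y [[w Sw <-]|[Cy|[u [k _ [w Sw <-]] [x Cx <-]]]].
  + apply: (in_disk w L) => // [|m _]; first exact: small.
    by apply: coding_map_dist q0' _ rhoq _ _ => //; exact: ltW.
  (* [C] is its own image under the empty word, the prefix of length 0 of any [w] in [S]. *)
  + by have [w Sw] := S0; exact: (orbitU w 0%N).
  + exact: orbitU.
- by rewrite [leRHS]mulrAC ler_wpM2l// mulr_ge0 ?powR_ge0// addr_ge0 ?powR_ge0.
- rewrite mulr_sumr; apply: coverable_bigcup => k _.
  by rewrite mulr_sumr; apply: coverable_bigcup => u _.
Qed.

Theorem theorem4p6 (R : realType) (n N : nat)
    (f : 'I_N -> 'rV[R]_n -> 'rV[R]_n) (rho : 'I_N -> R)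
    (rho01 : forall i, 0 < rho i /\ rho i < 1)
    (f_sim : forall i, is_similarity (rho i) (f i))
    (C : set 'rV[R]_n) (C_nonempty : C !=set0) (C_compact : compact C)
    (E : set 'rV[R]_n) (E_sss : sub_self_similar f E)
    (S : set (code_space N)) (S_compact : compact S) (S_shift : shift_closed S)
    (E_coded : E = coding_map f @` S)
    (s : R) (s_ge0 : 0 <= s) (tau_s : tau rho S s = 1) :
  let EC := E `|` orbital_set f S C in
  (maxe (upper_box_dim E) (upper_box_dim C) <= upper_box_dim EC)%E /\
  (upper_box_dim EC <= maxe s%:E (upper_box_dim C))%E.
Proof.
move=> EC; split.
  rewrite ge_max; apply/andP; split; apply: upper_box_dim_sub => x Ax.
    by left.
  by right; left.
have S0 : S !=set0.
  have [[x]] := E_sss.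
  by rewrite E_coded => -[w Sw _] _ _; exists w.
(* It suffices to treat real [t] strictly above the maximum, where both [tau rho S s = 1] and the
   covers of [C] leave room in the exponent. *)
have EC_le t : (maxe s%:E (upper_box_dim C) < t%:E)%E ->
    (upper_box_dim EC <= t%:E)%E.
  rewrite gt_max lte_fin => /andP[st /upper_box_dim_lt[e e0 cC]].
  have [M [D [D0 cEC]]] :=
    coverable_orbit rho01 f_sim C_compact S0 s_ge0 st tau_s e0 cC.
  by apply: (@upper_box_dim_le_const _ _ _ M t D) => // d dD; rewrite /EC E_coded; exact: cEC.
(* This excludes the value [-oo] in the case analysis on the maximum. *)
have : (s%:E <= maxe s%:E (upper_box_dim C))%E by rewrite le_max lexx.
case: (maxe _ _) EC_le => [m EC_le _| _ _|//]; last exact: leey.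
apply/lee_addgt0Pr => h h0; rewrite -EFinD; apply: EC_le.
by rewrite lte_fin ltrDl.
Qed.
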